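(* Let $n \ge 0$ and $k \ge 2$ be integers, let $H_n=\{0,1\}^n$, and let $\mu$ be a probability product measure on $H_n$. Suppose $$H_n = A \sqcup C_1 \sqcup C_2 \sqcup \dots \sqcup C_k \sqcup B$$ is a partition of $H_n$ into pairwise disjoint (possibly empty) subsets such that for every $i\in\{1,\dots,k\}$ the set $A \cup C_i$ is closed upwards. Then $$\mu(A)\,\mu(B) \ \ge\ e_2\big(\mu(C_1), \dots, \mu(C_k)\big).$$
   Context: $H_n=\{0,1\}^n$ is the $n$-dimensional discrete hypercube with the coordinatewise partial order. A subset of $H_n$ is closed upwards if together with each vector $v$ it contains every $w \in H_n$ with $w \ge v$ coordinatewise. A measure $\mu$ on $H_n$ is a product measure if there are probability measures $\mu_1,\dots,\mu_n$ on $\{0,1\}$ (not necessarily equal) with $\mu=\mu_1\times\dots\times\mu_n$. The second elementary symmetric polynomial is $e_2(x_1,\dots,x_k)=\sum_{1\le i<j\le k}x_ix_j$. *)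

(* Defs.v *)
From mathcomp Require Import all_boot all_order all_algebra.
From mathcomp Require Import all_classical all_reals all_analysis.
Set Implicit Arguments.
Unset Strict Implicit.
Unset Printing Implicit Defensive.
Import Order.TTheory GRing.Theory Num.Theory.

Local Open Scope classical_set_scope.
Local Open Scope ring_scope.

Notation hypercube n := (n.-tuple bool).

(* The sigma-algebra of the library on [n.-tuple bool] is the product of the
   discrete ones; it is discrete, so a measure is meaningful on every subset. *)
Lemma hypercube_measurable (n : nat) (X : set (hypercube n)) : measurable X.
Proof.
have -> : X = \bigcup_(v in X) \bigcap_(i in [set: 'I_n])
    ((fun w : hypercube n => tnth w i) @^-1` [set tnth v i]).
  apply/seteqP; split => [v Xv|w [v Xv vw]].
    by exists v.
  suff -> : w = v by [].
  by apply: eq_from_tnth => i; exact: vw.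
apply: fin_bigcup_measurable; first exact: finite_finset.
move=> v _; apply: fin_bigcap_measurable; first exact: finite_finset.
move=> i _; rewrite -[X in measurable X]setTI.
exact: measurable_tnth.
Qed.

Definition upward_closed (n : nat) (X : set (hypercube n)) : Prop :=
  forall v w : hypercube n,
    X v -> (forall i : 'I_n, (tnth v i <= tnth w i)%O) -> X w.

Definition box (n : nat) (S : 'I_n -> set bool) : set (hypercube n) :=
  [set v | forall i : 'I_n, S i (tnth v i)].

(* The product of the [nu i] is the only measure with these values on boxes;
   the library has no [n]-ary product of measures. *)
Definition product_measure (R : realType) (n : nat)
    (mu : probability (hypercube n) R) : Prop :=
  exists nu : 'I_n -> probability bool R,
    forall S : 'I_n -> set bool,
      mu (box S) = (\prod_(i < n) nu i (S i))%E.

Definition e2 (R : realType) (k : nat) (x : 'I_k -> R) : R :=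
  \sum_(i < k) \sum_(j < k | (i < j)%N) x i * x j.

(* The pieces may be empty. *)
Definition hypercube_partition (n k : nat) (A B : set (hypercube n))
    (C : 'I_k -> set (hypercube n)) : Prop :=
  [/\ A `|` \bigcup_(i in [set: 'I_k]) C i `|` B = [set: hypercube n],
      A `&` B = set0,
      (forall i : 'I_k, A `&` C i = set0),
      (forall i : 'I_k, C i `&` B = set0) &
      (forall i j : 'I_k, i != j -> C i `&` C j = set0)].

(* Main.v *)
(** Induction on n.  Split the cube along the first coordinate, and let (a, b, c)
    and (a', b', c') be the vectors of masses of A, B, C on the lower and on the
    upper face.  The form F(a, b, c) = a b - e2(c) is quadratic, so at the mixture
    with weights 1 - p, p it equals (1 - p) F(a, b, c) + p F(a', b', c')
    - p (1 - p) F(d), where d is the difference of the two vectors; it suffices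
    that F(d) <= 0.  Going up, a point can only move from B to some C_i, from some
    C_i to A, or from B to A.  If x_i is the mass of points entering C_i and y_i
    that of points leaving it, then sum x <= b - b', sum y <= a' - a and
    e2(c' - c) = e2(x - y) >= - (sum x) (sum y). *)
Require Import Defs.
From mathcomp Require Import all_boot all_order all_algebra.
From mathcomp Require Import all_classical all_reals all_analysis.
From mathcomp Require Import ring lra.
Set Implicit Arguments.
Unset Strict Implicit.
Unset Printing Implicit Defensive.
Import Order.TTheory GRing.Theory Num.Theory.

Local Open Scope classical_set_scope.
Local Open Scope ring_scope.

Lemma e2_ge0 (R : realType) (k : nat) (x : 'I_k -> R) :
  (forall i, 0 <= x i) -> 0 <= e2 x.
Proof.
by move=> x0; apply: sumr_ge0 => i _; apply: sumr_ge0 => j _; apply: mulr_ge0.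
Qed.

Lemma e2_mix (R : realType) (k : nat) (p : R) (x y : 'I_k -> R) :
  e2 (fun i => (1 - p) * x i + p * y i) =
  (1 - p) * e2 x + p * e2 y - p * (1 - p) * e2 (fun i => y i - x i).
Proof.
rewrite /e2 -mulNr !mulr_sumr -!big_split /=.
apply: eq_bigr => i _; rewrite !mulr_sumr -!big_split /=.
by apply: eq_bigr => j _; ring.
Qed.

(** The diagonal is split off, and each ordered pair [(i, j)] with [j < i] is folded onto its mirror
    image. The remaining double sum is the cross term in the expansion of [e2 (x - y)]. *)
Lemma sum_mul_sum_e2 (R : realType) (k : nat) (x y : 'I_k -> R) :
  (\sum_i x i) * (\sum_i y i) =
  \sum_i x i * y i + \sum_(i < k) \sum_(j < k | (i < j)%N) (x i * y j + y i * x j).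
Proof.
have -> : \sum_(i < k) \sum_(j < k | (i < j)%N) (x i * y j + y i * x j) =
   \sum_(i < k) (\sum_(j < k | (i < j)%N) x i * y j +
                 \sum_(j < k | (j < i)%N) x i * y j).
  rewrite big_split /=.
  under eq_bigr do rewrite big_split /=.
  rewrite big_split /=; congr (_ + _).
  rewrite (exchange_big_dep xpredT) //=.
  by apply: eq_bigr => i _; apply: eq_bigr => j _; rewrite mulrC.
rewrite -big_split mulr_suml /=; apply: eq_bigr => i _.
rewrite mulr_sumr (bigD1 i) //=; congr (_ + _).
rewrite (bigID (fun j : 'I_k => (i < j)%N)) /=; congr (_ + _).
  by apply: eq_bigl => j; rewrite -val_eqE /=; case: ltngtP.
by apply: eq_bigl => j; rewrite -val_eqE /=; case: ltngtP.
Qed.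

(** After expansion the two sides differ by [e2 x], [e2 y] and the diagonal sum of the [x i * y i],
    all nonnegative. *)
Lemma e2_sub_ge (R : realType) (k : nat) (x y : 'I_k -> R) :
  (forall i, 0 <= x i) -> (forall i, 0 <= y i) ->
  - ((\sum_i x i) * (\sum_i y i)) <= e2 (fun i => x i - y i).
Proof.
move=> x0 y0; rewrite sum_mul_sum_e2.
have xy0 : 0 <= \sum_i x i * y i by apply: sumr_ge0 => i _; exact: mulr_ge0.
have -> : e2 (fun i => x i - y i) = e2 x + e2 y -
    \sum_(i < k) \sum_(j < k | (i < j)%N) (x i * y j + y i * x j).
  rewrite /e2 -sumrN -!big_split /=; apply: eq_bigr => i _.
  rewrite -sumrN -!big_split /=; apply: eq_bigr => j _; ring.
have := e2_ge0 x0; have := e2_ge0 y0; lra.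
Qed.

(** Plain real weights stand in for the measure, so that the induction drops a coordinate by
    reindexing [w]. *)
Definition mass (R : realType) (n : nat) (w : 'I_n -> bool -> R)
    (X : set (hypercube n)) : R :=
  \sum_(v | v \in X) \prod_i w i (tnth v i).

Section Mass.
Context {R : realType} {n : nat} {w : 'I_n -> bool -> R}.
Hypothesis w_ge0 : forall i b, 0 <= w i b.

Lemma weight_ge0 (v : hypercube n) : 0 <= \prod_i w i (tnth v i).
Proof. by apply: prodr_ge0. Qed.

Lemma mass_ge0 (X : set (hypercube n)) : 0 <= mass w X.
Proof. by apply: sumr_ge0 => v _; exact: weight_ge0. Qed.

Lemma mass_setID (X Y : set (hypercube n)) :
  mass w X = mass w (X `&` Y) + mass w (X `\` Y).
Proof.
rewrite /mass (bigID (fun v => v \in Y)) /=; congr (_ + _).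
  by apply: eq_bigl => v; rewrite in_setI.
by apply: eq_bigl => v; rewrite in_setD.
Qed.

(** The common part cancels; with two faces of one set this reads as mass entering minus mass
    leaving. *)
Lemma mass_setDB (X Y : set (hypercube n)) :
  mass w X - mass w Y = mass w (X `\` Y) - mass w (Y `\` X).
Proof. by rewrite (mass_setID X Y) (mass_setID Y X) [Y `&` X]setIC; ring. Qed.

Lemma mass_set0 : mass w set0 = 0.
Proof. by rewrite /mass big_pred0// => v; rewrite in_set0. Qed.

(** After exchanging the sums, disjointness lets the weight of each point count at most once. *)
Lemma sum_mass_le (k : nat) (D : 'I_k -> set (hypercube n))
    (X : set (hypercube n)) :
  (forall i, D i `<=` X) -> (forall i j, i != j -> D i `&` D j = set0) ->
  \sum_i mass w (D i) <= mass w X.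
Proof.
move=> DX disj; rewrite /mass (exchange_big_dep (fun v => v \in X)) /=; last first.
  by move=> i v _; rewrite !inE; exact: DX.
apply: ler_sum => v _.
have [[i Div]|nD] := pselect (exists i, D i v).
  rewrite (big_pred1 i) // => j; apply/idP/eqP => [|->]; rewrite inE //.
  move=> Djv; apply: contrapT => /eqP /disj; apply/eqP/set0P; by exists v.
rewrite big_pred0 ?weight_ge0 // => i; apply/negP; rewrite inE => Div.
by apply: nD; exists i.
Qed.

End Mass.

Definition face (n : nat) (b : bool) (X : set (hypercube n.+1)) :
  set (hypercube n) := (fun v : hypercube n => cons_tuple b v) @^-1` X.

Lemma mass_face (R : realType) (n : nat) (w : 'I_n.+1 -> bool -> R)
    (X : set (hypercube n.+1)) :
  mass w X = w ord0 false * mass (fun i => w (lift ord0 i)) (face false X)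
           + w ord0 true * mass (fun i => w (lift ord0 i)) (face true X).
Proof.
rewrite /mass (reindex (fun p : bool * n.-tuple bool => cons_tuple p.1 p.2)) /=; last first.
  exists (fun v => (thead v, behead_tuple v)) => [[b v] _|v _] /=.
    by rewrite theadE; congr pair; apply: val_inj.
  by rewrite [RHS]tuple_eta; apply: val_inj.
rewrite -(pair_big_dep xpredT (fun b v => (cons_tuple b v) \in X)
  (fun b v => \prod_i w i (tnth (cons_tuple b v) i))) /=.
rewrite big_bool /= addrC; congr (_ + _); rewrite mulr_sumr;
  apply: eq_big => [v|v _]; rewrite /face ?inE //;
  rewrite big_ord_recl; congr (_ * _); apply: eq_bigr => i _;
  by rewrite tnthS.
Qed.

Lemma face_partition (n k : nat) (b : bool) (A B : set (hypercube n.+1))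
    (C : 'I_k -> set (hypercube n.+1)) :
  hypercube_partition A B C ->
  hypercube_partition (face b A) (face b B) (fun i => face b (C i)).
Proof.
rewrite /face => -[cov AB AC CB CC]; split.
- by rewrite -preimage_bigcup -!preimage_setU cov preimage_setT.
- by rewrite -preimage_setI AB preimage_set0.
- by move=> i; rewrite -preimage_setI AC preimage_set0.
- by move=> i; rewrite -preimage_setI CB preimage_set0.
- by move=> i j ij; rewrite -preimage_setI CC ?preimage_set0.
Qed.

Lemma face_upward_closed (n : nat) (b : bool) (X : set (hypercube n.+1)) :
  upward_closed X -> upward_closed (face b X).
Proof.
move=> up v v' Xv vv'; apply: up Xv _ => i.
by case: (unliftP ord0 i) => [j|] ->; rewrite ?tnth0 ?tnthS.
Qed.

Lemma face_subset (n : nat) (X : set (hypercube n.+1)) :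
  upward_closed X -> face false X `<=` face true X.
Proof.
move=> up v Xv; apply: up Xv _ => i.
by case: (unliftP ord0 i) => [j|] ->; rewrite ?tnth0 ?tnthS.
Qed.

Lemma mass_e2_le (R : realType) (n k : nat) (hk : (2 <= k)%N)
    (w : 'I_n -> bool -> R) (w_ge0 : forall i b, 0 <= w i b)
    (w_sum1 : forall i, w i false + w i true = 1)
    (A B : set (hypercube n)) (C : 'I_k -> set (hypercube n)) :
  hypercube_partition A B C -> (forall i, upward_closed (A `|` C i)) ->
  e2 (fun i => mass w (C i)) <= mass w A * mass w B.
Proof.
elim: n => [|n IH] in w w_ge0 w_sum1 A B C *.
  (* The 0-cube has one point, so of two disjoint sets one is empty and every product in [e2]
     vanishes. *)
  move=> [_ _ _ _ CC] _.
  rewrite (_ : e2 _ = 0) ?mulr_ge0 ?mass_ge0 //.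
  apply: big1 => i _; apply: big1 => j ij.
  have /CC CC0 : i != j by rewrite -val_eqE /= ltn_eqF.
  have [C0|nC0] := pselect (C i [tuple]).
    suff -> : C j = set0 by rewrite mass_set0 mulr0.
    apply/seteqP; split => // v; rewrite (tuple0 v) => Cj.
    by rewrite -CC0.
  suff -> : C i = set0 by rewrite mass_set0 mul0r.
  by apply/seteqP; split => // v; rewrite (tuple0 v).
move=> part up.
pose w' i := w (lift ord0 i).
pose A0 := face false A; pose A1 := face true A.
pose B0 := face false B; pose B1 := face true B.
pose C0 i := face false (C i); pose C1 i := face true (C i).
have IHb b := IH w' (fun i => w_ge0 _) (fun i => w_sum1 _) _ _ _
  (face_partition b part) (fun i => face_upward_closed (b := b) (up i)).
have [cov0 AB0 AC0 CB0 CC0] := face_partition false part.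
have [cov1 AB1 AC1 CB1 CC1] := face_partition true part.
have no (X Y : set (hypercube n)) v : X `&` Y = set0 -> X v -> Y v -> False.
  by move=> XY Xv Yv; have : (X `&` Y) v by []; rewrite XY.
have mono i v : A0 v \/ C0 i v -> A1 v \/ C1 i v := face_subset (up i) (t:=v).
(* Here [2 <= k] enters: a point of [A0] that missed [A1] would lie in [C1 i] for two distinct
   indices. *)
have sA : A0 `<=` A1.
  move=> v A0v; pose i0 := Ordinal (ltnW hk); pose i1 := Ordinal hk.
  have [//|Ci0] := mono i0 v (or_introl A0v).
  have [//|Ci1] := mono i1 v (or_introl A0v).
  by case: (no _ _ v (CC1 i0 i1 isT)).
(* A point of [A0] or [C0 i] goes up into [A1] or [C1 i], both disjoint from [B1]. *)
have sB : B1 `<=` B0.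
  move=> v B1v; have : setT v by []; rewrite -cov0 => -[[A0v|[i _ C0v]]|//].
    by case: (no _ _ v AB1) => //; exact: sA.
  case: (mono i v (or_intror C0v)) => [A1v|C1v].
    by case: (no _ _ v AB1).
  by case: (no _ _ v (CB1 i)).
have w'0 i b : 0 <= w' i b by exact: w_ge0.
pose x i := mass w' (C1 i `\` C0 i); pose y i := mass w' (C0 i `\` C1 i).
(* Points entering [C1 i] come from [B0]: those of [A0] stay in [A1], and those of [C0 j] with
   [j != i] go to [A1] or [C1 j]. *)
have sx : \sum_i x i <= mass w' B0 - mass w' B1.
  rewrite mass_setDB (_ : B1 `\` B0 = set0) ?setD_eq0 // mass_set0 subr0.
  apply: sum_mass_le => // [i v [C1v nC0v]|i j ij]; last first.
    by apply/seteqP; split => // v [[Ci _] [Cj _]]; exact: (no _ _ v (CC1 i j ij)).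
  split; last by move=> B1v; exact: (no _ _ v (CB1 i)).
  have : setT v by []; rewrite -cov0 => -[[A0v|[j _ C0v]]|//].
    by case: (no _ _ v (AC1 i)) => //; exact: sA.
  have ij : i != j by apply/eqP => ij; apply: nC0v; rewrite ij.
  case: (mono j v (or_intror C0v)) => [A1v|C1jv].
    by case: (no _ _ v (AC1 i)).
  by case: (no _ _ v (CC1 i j ij)).
(* Points leaving [C0 i] land in [A1], because [A] together with [C i] is closed upwards. *)
have sy : \sum_i y i <= mass w' A1 - mass w' A0.
  rewrite mass_setDB (_ : A0 `\` A1 = set0) ?setD_eq0 // mass_set0 subr0.
  apply: sum_mass_le => // [i v [C0v nC1v]|i j ij]; last first.
    by apply/seteqP; split => // v [[Ci _] [Cj _]]; exact: (no _ _ v (CC0 i j ij)).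
  split; last by move=> A0v; exact: (no _ _ v (AC0 i)).
  by case: (mono i v (or_intror C0v)).
have x0 i : 0 <= x i by exact: mass_ge0.
have y0 i : 0 <= y i by exact: mass_ge0.
have X0 : 0 <= \sum_i x i by exact: sumr_ge0.
have Y0 : 0 <= \sum_i y i by exact: sumr_ge0.
have e2d : - ((\sum_i x i) * (\sum_i y i)) <=
    e2 (fun i => mass w' (C1 i) - mass w' (C0 i)).
  rewrite (_ : e2 _ = e2 (fun i => x i - y i)); first exact: e2_sub_ge.
  by congr e2; apply/funext => i; rewrite mass_setDB.
set p := w ord0 true.
have wf : w ord0 false = 1 - p by rewrite -(w_sum1 ord0) addrK.
have p0 : 0 <= p by exact: w_ge0.
have q0 : 0 <= 1 - p by rewrite -wf; exact: w_ge0.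
rewrite (_ : (fun i => _) =
    (fun i => (1 - p) * mass w' (C0 i) + p * mass w' (C1 i))); last first.
  by apply/funext => i; rewrite mass_face wf.
rewrite e2_mix [mass w A]mass_face [mass w B]mass_face wf -/p.
rewrite -/w' -/A0 -/A1 -/B0 -/B1.
have IH0 := ler_wpM2l q0 (IHb false); have IH1 := ler_wpM2l p0 (IHb true).
rewrite -/A0 -/A1 -/B0 -/B1 in IH0 IH1.
(* This is the term [- p (1 - p) F(d)]; the factor for [B] is written [B0] minus [B1] to make it
   nonnegative. The bounds [sx] and [sy] multiply to dominate the negative part in [e2d]. *)
have key : 0 <= p * (1 - p) * (e2 (fun i => mass w' (C1 i) - mass w' (C0 i))
    + (mass w' A1 - mass w' A0) * (mass w' B0 - mass w' B1)).
  apply: mulr_ge0; first exact: mulr_ge0.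
  have := ler_pM X0 Y0 sx sy; lra.
apply: le_trans (lerB (lerD IH0 IH1) (lexx _)) _.
(* With the induction hypotheses inserted, the gap between the two sides is exactly the quantity in
   [key]. *)
rewrite -subr_ge0; apply: le_trans key _; rewrite le_eqVlt; apply/orP; left.
apply/eqP; ring.
Qed.

(** A singleton is a box, so its measure is the product of the coordinate weights; finite additivity
    over points does the rest. *)
Lemma fine_product_measure (R : realType) (n : nat)
    (mu : probability (hypercube n) R) (nu : 'I_n -> probability bool R) :
  (forall S, mu (box S) = (\prod_(i < n) nu i (S i))%E) ->
  forall X, fine (mu X) = mass (fun i b => fine (nu i [set b])) X.
Proof.
move=> nuP X.
have mu1 (v : hypercube n) :
    mu [set v] = (\prod_i fine (nu i [set tnth v i]))%:E.
  rewrite (_ : [set v] = box (fun i => [set tnth v i])); last first.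
    by apply/seteqP; split => [u -> //|u uv]; exact: eq_from_tnth.
  rewrite nuP -prodEFin; apply: eq_bigr => i _.
  by rewrite fineK // fin_num_measure.
rewrite -[X in mu X]image_id -bigcup_imset1 measure_fin_bigcup; last 3 first.
- exact: finite_finset.
- apply/trivIsetP => u v _ _ /eqP uv; apply/seteqP; split => // t [/= -> ?].
  by case: uv.
- by move=> v _; exact: hypercube_measurable.
rewrite -[X in (\sum_(_ \in X) _)%R]set_mem_set.
rewrite -(bigfs _ (index_enum_uniq _)) => [|v _]; last by rewrite mem_index_enum.
by rewrite (eq_bigr _ (fun v _ => mu1 v)) sumEFin.
Qed.

Theorem theorem2p1 (R : realType) (n k : nat) (hk : (2 <= k)%N)
    (mu : probability (hypercube n) R) (hmu : product_measure mu)
    (A B : set (hypercube n)) (C : 'I_k -> set (hypercube n))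
    (hpart : hypercube_partition A B C)
    (hup : forall i : 'I_k, upward_closed (A `|` C i)) :
  fine (mu A) * fine (mu B) >= e2 (fun i : 'I_k => fine (mu (C i))).
Proof.
have [nu nuP] := hmu.
have nu_fin i X : nu i X \is a fin_num by exact: fin_num_measure.
pose w i b := fine (nu i [set b]).
have mu_mass X : fine (mu X) = mass w X by exact: fine_product_measure.
rewrite (_ : (fun i => _) = (fun i => mass w (C i))); last by apply/funext => i.
rewrite !mu_mass; apply: mass_e2_le => // [i b|i]; first exact: fine_ge0.
rewrite -fineD // -measureU //.
  have -> : [set false; true] = setT.
    by apply/seteqP; split => // -[] _; [right|left].
  have nu1 : nu i setT = 1%E := probability_setT (nu i).
  by rewrite -[RHS]/(fine 1%E) -nu1.
by apply/seteqP; split => // -[] [].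
Qed.
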